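(* Let $\kappa$ be an infinite cardinal. If there exists a productively quasi-Lindelöf space $X$ with $w(X)\leq\kappa$ that is not powerfully quasi-Lindelöf, then there exists a zero-dimensional productively Lindelöf space $Y$ with $w(Y)\leq\kappa$ that is not powerfully Lindelöf.
   Context: A space is an arbitrary topological space unless separation axioms are stated. A space is quasi-Lindelöf if every open cover of it has a countable subcover (no separation axioms). A space is Lindelöf if it is regular (which includes $\mathsf{T}_1$) and quasi-Lindelöf. A space $X$ is productively Lindelöf (respectively productively quasi-Lindelöf) if $X\times Z$ is Lindelöf (respectively quasi-Lindelöf) for every Lindelöf space $Z$; in both cases $Z$ ranges over Lindelöf, hence regular, spaces. A space $X$ is powerfully Lindelöf (respectively powerfully quasi-Lindelöf) if $X^\omega$ with the product topology is Lindelöf (respectively quasi-Lindelöf). A non-empty space is zero-dimensional if it is $\mathsf{T}_1$ and has a base consisting of clopen sets. The weight $w(X)$ is the least cardinal $\lambda$ such that $X$ has a base of size $\lambda$. *)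

(* Defs.v *)
From mathcomp Require Import all_boot.
From mathcomp Require Import boolp classical_sets cardinality topology.

Set Implicit Arguments.
Unset Strict Implicit.
Unset Printing Implicit Defensive.

Local Open Scope classical_set_scope.
Local Open Scope card_scope.

Definition quasi_lindelof (X : topologicalType) : Prop :=
  forall C : set (set X),
    C `<=` open -> [set: X] `<=` \bigcup_(U in C) U ->
    exists D : set (set X),
      [/\ D `<=` C, countable D & [set: X] `<=` \bigcup_(U in D) U].

(* [regular_space] alone does not include the T1 axiom. *)
Definition lindelof (X : topologicalType) : Prop :=
  [/\ accessible_space X, regular_space X & quasi_lindelof X].

Definition productively_lindelof (X : topologicalType) : Prop :=
  forall Z : topologicalType, lindelof Z -> lindelof (X * Z)%type.

Definition productively_quasi_lindelof (X : topologicalType) : Prop :=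
  forall Z : topologicalType, lindelof Z -> quasi_lindelof (X * Z)%type.

Definition omega_power (X : topologicalType) : topologicalType :=
  prod_topology (fun _ : nat => X).

Definition powerfully_lindelof (X : topologicalType) : Prop :=
  lindelof (omega_power X).

Definition powerfully_quasi_lindelof (X : topologicalType) : Prop :=
  quasi_lindelof (omega_power X).

(* The library's [zero_dimensional] only asks that distinct points be separated
   by a clopen set, which is weaker than having a base of clopen sets. *)
Definition zero_dimensional_space (X : topologicalType) : Prop :=
  [/\ [set: X] !=set0, accessible_space X
    & exists2 B : set (set X), basis B & B `<=` clopen].

(* Cardinals are represented by sets up to equipotence [#=]: the weight of [X]
   is the cardinality of any base satisfying [least_basis]. *)
Definition least_basis (X : topologicalType) (B : set (set X)) : Prop :=
  basis B /\ forall B' : set (set X), basis B' -> B #<= B'.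

Definition weight_le (X : topologicalType) (K : Type) : Prop :=
  exists2 B : set (set X), least_basis B & B #<= [set: K].

(* Main.v *)
Require Import Defs.
From mathcomp Require Import all_boot.
From mathcomp Require Import boolp classical_sets functions cardinality topology.

(** Index a base of [X] as a family [u : K -> set X], possible because the
    weight of [X] is at most the cardinality of [K]. A point [x] is then described by its
    trace, the set of indices [k] with [u k x], seen as a point of the Cantor
    cube [K -> bool]. Take for [Y] the upward closure of the set of traces.
    As a subspace of the cube, [Y] is zero-dimensional, and its finite
    cylinders form a base of cardinality at most that of [K].

    The upper set above the trace of [x] is a product of subsets of [bool],
    hence compact, and it depends upper semicontinuously on [x]: each of its
    neighbourhoods contains the upper sets of all points near [x]. So [Y] is
    the image of [X] under a compact-valued upper semicontinuous map, and
    likewise [Y * Z] is such an image of [X * Z]; these maps preserve the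
    quasi-Lindelof property ([upper_hull_prod_quasi_lindelof]). Since [Y] and
    the Lindelof space [Z] are regular and T1, so is [Y * Z]; hence [Y] is
    productively Lindelof.

    In the other direction, membership in a basic open set of the power of [X]
    is a condition of the form: finitely many given bits of the traces are
    true. The same condition makes sense in the power of [Y] and is open
    there, and any point of the power of [Y] lies above a sequence of traces,
    hence satisfies each condition that this sequence satisfies. An open
    cover of the power of [X] thus induces one of the power of [Y], and a
    countable subcover of the latter restricts to one of the former along the
    trace map ([omega_power_quasi_lindelof_upper_hull]). Hence the power of
    [Y] is not Lindelof.

    Both transfers of the quasi-Lindelof property are instances of
    [quasi_lindelof_transfer]. The remaining ingredients are two facts about
    cardinals, obtained from Zorn's lemma: every nonempty family of sets has a
    member of least cardinality, so that a base of least cardinality exists,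
    and the square of an infinite type embeds into it, which bounds the number
    of cylinders. *)

Local Open Scope classical_set_scope.
Local Open Scope card_scope.

(** * Cardinals of infinite types *)

Lemma card_le_injP {T : Type} {U : pointedType} {A : set T} {B : set U} :
  A #<= B <->
  exists2 f : T -> U, (forall x, A x -> B (f x))
    & (forall x y, A x -> A y -> f x = f y -> x = y).
Proof.
split=> [/pcard_leP/injfunPex[f fAB finj]|[f fAB finj]].
  by exists f => // x y /mem_set Ax /mem_set Ay; exact: finj.
apply/pcard_leP/injfunPex; exists f => // x y /set_mem Ax /set_mem Ay.
exact: finj.
Qed.

(** Among the sets of choice functions on [F] that are pairwise different at
    every member of [F], take a maximal one, [S]. If each member [A] of [F] had
    an element missed by the evaluations of [S] at [A], these elements would
    form a choice function that could be added to [S]. So evaluation at some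
    [A] maps [S] onto [A], while evaluation at any [B] embeds [S] into [B]. *)
Lemma exists_card_le_least {T : Type} (F : set (set T)) :
  F !=set0 -> exists2 A, F A & forall B, F B -> A #<= B.
Proof.
move=> [A0 FA0].
pose P (S : set (set T -> T)) := forall B, F B ->
  (forall s, S s -> B (s B)) /\
  (forall s t, S s -> S t -> s B = t B -> s = t).
have [|S [PS Smax]] := @Zorn_bigcup _ P.
  move=> G GP Gtot B FB; split=> [s [S GS Ss]|s t [S GS Ss] [S' GS' S't]].
    exact: (GP _ GS _ FB).1.
  have [SS'|S'S] := Gtot _ _ GS GS'.
    by apply: (GP _ GS' _ FB).2 => //; exact: SS'.
  by apply: (GP _ GS _ FB).2 => //; exact: S'S.
have [[A FA AS]|noA] := pselect (exists2 A, F A &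
    A `<=` (fun s : set T -> T => s A) @` S).
  exists A => // B FB; apply: (card_le_trans (subset_card_le AS)).
  apply: (card_le_trans (card_image_le _ _)).
  have Sinj : {in S &, injective (fun s : set T -> T => s B)}.
    by move=> s t /set_mem Ss /set_mem St; exact: (PS _ FB).2.
  have := inj_card_eq Sinj; rewrite card_eq_le => /andP[_ /card_le_trans]; apply.
  by apply: subset_card_le => _ [s Ss <-]; exact: (PS _ FB).1.
have fresh B : F B -> exists b, B b /\ forall s, S s -> s B <> b.
  move=> FB; apply: contrapT => nob; apply: noA; exists B => // b Bb.
  apply: contrapT => bS; apply: nob; exists b; split=> // s Ss sB.
  by apply: bS; exists s.
have [b0 _] := fresh _ FA0.
have /choice[t tP] : forall B, exists b, F B -> B b /\ forall s, S s -> s B <> b.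
  move=> B; have [/fresh[b bP]|nFB] := pselect (F B); first by exists b.
  by exists b0.
exfalso; apply: (Smax (S `|` [set t])).
  split=> [s Ss|/(_ t)]; first by left.
  have tt : (S `|` [set t]) t by right.
  by move=> /(_ tt) /((tP _ FA0).2).
move=> B FB; have [Bt tS] := tP _ FB; have [SB Sinj] := PS _ FB.
split=> [s [/SB//|->//]|s s' [Ss|->] [Ss'|->] //].
- exact: Sinj.
- by move/tS => /(_ Ss).
- by move/esym/tS => /(_ Ss').
Qed.

Lemma card_le_total {T : Type} (A B : set T) : A #<= B \/ B #<= A.
Proof.
have [|C [->|->] Cle] := @exists_card_le_least _ [set A; B].
- by exists A; left.
- by left; apply: Cle; right.
- by right; apply: Cle; left.
Qed.

(** Zorn's lemma gives a maximal infinite [S] with an injection of [S * S] into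
    [S]. Any set disjoint from [S] and no larger than [S] can be absorbed:
    its union with [S] still embeds into [S]. If the complement of [S] is no
    larger than [S], the whole type therefore embeds into [S], and so does its
    square. Otherwise the complement contains a copy [A] of [S], and the
    injection extends to the square of the union of [S] and [A] by sending the
    new pairs into [A], against maximality. The injections are represented by
    their graphs, so that extension is inclusion. *)
Lemma card_le_square {K : Type} :
  infinite_set [set: K] -> [set: K * K] #<= [set: K].
Proof.
elim/Ppointed: K => K Kinf; first by rewrite empty_eq0 in Kinf *.
have /card_le_injP[i _ iI] : [set: nat] #<= [set: K] by apply/infiniteP.
have {}iI : injective i by move=> m n; exact: iI.
pose fld (G : set (K * K * K)) := [set x | exists y z, G (x, y, z)].
pose Q G := [/\ forall x y, fld G x -> fld G y -> exists z, G (x, y, z),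
  forall x y z, G (x, y, z) -> fld G y /\ fld G z
  & forall p q z, G (p, z) -> G (q, z) -> p = q].
(* The empty graph is admitted because it is the union of the empty chain;
   a maximal graph is not empty, as [G1] below shows. *)
pose P G := G = set0 \/ Q G /\ infinite_set (fld G).
have [|G [PG Gmax]] := @Zorn_bigcup _ P.
  move=> F FP Ftot.
  have [F0|/set0P[[p0 z0] [G0 FG0 G0p]]] :=
    eqVneq (\bigcup_(X in F) X) set0; first by left.
  have fldS (G G' : set (K * K * K)) : G `<=` G' -> fld G `<=` fld G'.
    by move=> GG' x [y [z /GG' ?]]; exists y, z.
  have FQ G w : F G -> G w -> Q G /\ infinite_set (fld G).
    by move=> /FP[->|].
  right; split; last first.
    apply: (sub_infinite_set _ (FQ _ _ FG0 G0p).2).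
    by apply: fldS => w Gw; exists G0.
  split=> [x y [x1 [x2 [G1 FG1 G1x]]] [y1 [y2 [G2 FG2 G2y]]]||].
  - have [G' FG' [G'x G'y]] : exists2 G', F G' & fld G' x /\ fld G' y.
      have [/fldS s|/fldS s] := Ftot _ _ FG1 FG2.
        by exists G2 => //; split; [apply: s; exists x1, x2|exists y1, y2].
      by exists G1 => //; split; [exists x1, x2|apply: s; exists y1, y2].
    have [x3 [x4 G'xx]] := G'x.
    have [[/(_ _ _ G'x G'y)[z zP] _ _] _] := FQ _ _ FG' G'xx.
    by exists z, G'.
  - move=> x y z [G FG Gz]; have [[_ /(_ _ _ _ Gz)[Gy Gz'] _] _] := FQ _ _ FG Gz.
    have GF : G `<=` \bigcup_(X in F) X by move=> w Gw; exists G.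
    by split; apply: fldS GF _ _.
  - move=> p q z [G1 FG1 G1p] [G2 FG2 G2q].
    have [s|s] := Ftot _ _ FG1 FG2.
      by have [[_ _ inj] _] := FQ _ _ FG2 G2q; apply: inj (s _ G1p) G2q.
    by have [[_ _ inj] _] := FQ _ _ FG1 G1p; apply: inj G1p (s _ G2q).
have {PG} [QG fldinf] : Q G /\ infinite_set (fld G).
  case: PG => // G0; exfalso.
  pose G1 := [set (i mn.1, i mn.2, i (pickle mn)) | mn in [set: nat * nat]].
  have fldG1 n : fld G1 (i n).
    by exists (i 0%N), (i (pickle (n, 0%N))); exists (n, 0%N).
  apply: (Gmax G1).
    rewrite G0; split=> [//|/(_ (i 0%N, i 0%N, i (pickle (0%N, 0%N))))].
    by apply; exists (0%N, 0%N).
  right; split; last first.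
    have /card_le_injP : exists2 f : nat -> K,
        (forall n, [set: nat] n -> fld G1 (f n)) &
        (forall m n, [set: nat] m -> [set: nat] n -> f m = f n -> m = n).
      by exists i => [n _|m n _ _ /iI].
    by move/infiniteP.
  split.
  - move=> x y [? [? [mn _ [<- _ _]]]] [? [? [mn' _ [<- _ _]]]].
    by exists (i (pickle (mn.1, mn'.1))); exists (mn.1, mn'.1).
  - by move=> x y z [mn _ [_ <- <-]].
  - move=> p q z [mn _ [<- <-]] [mn' _ [<-]].
    by move=> /iI /(pcan_inj pickleK) ->.
have [Gtot Gran Ginj] := QG.
set S := fld G in Gtot Gran fldinf.
have /choice[f fP] : forall p : K * K, exists z, S p.1 -> S p.2 -> G (p, z).
  move=> [x y]; have [Sx|nSx] := pselect (S x); last by exists point.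
  have [Sy|nSy] := pselect (S y); last by exists point.
  by have [z Gz] := Gtot _ _ Sx Sy; exists z.
have fS p : S p.1 -> S p.2 -> S (f p).
  by case: p => x y Sx Sy; exact: (Gran _ _ _ (fP (x, y) Sx Sy)).2.
have fI x y x' y' : S x -> S y -> S x' -> S y' -> f (x, y) = f (x', y') ->
    x = x' /\ y = y'.
  move=> Sx Sy Sx' Sy' fE; have := fP (x', y') Sx' Sy'.
  by rewrite -fE => /(Ginj _ _ _ (fP (x, y) Sx Sy))[-> ->].
have [a [b [Sa Sb ab]]] : exists a b, [/\ S a, S b & a <> b].
  have /card_le_injP[h hS hI] : [set: nat] #<= S by apply/infiniteP.
  by exists (h 0%N), (h 1%N); split; [exact: hS|exact: hS|move/hI => /(_ I I)].
(* The first coordinates [a] and [b] keep the images of [S] and [A] apart. *)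
have absorb (A : set K) : A `<=` ~` S -> A #<= S -> S `|` A #<= S.
  move=> AS /card_le_injP[j jS jI]; apply/card_le_injP.
  exists (fun x => if `[< S x >] then f (a, x) else f (b, j x)).
    move=> x [Sx|Ax]; first by rewrite asboolT //; exact: fS.
    by rewrite asboolF; [apply: fS => //=; exact: jS|exact: AS].
  move=> x y [Sx|Ax] [Sy|Ay].
  - by rewrite !asboolT // => /(fI _ _ _ _ Sa Sx Sa Sy)[].
  - rewrite asboolT // asboolF; last exact: AS.
    by move=> /(fI _ _ _ _ Sa Sx Sb (jS _ Ay))[].
  - rewrite asboolF; last exact: AS.
    rewrite asboolT //.
    by move=> /(fI _ _ _ _ Sb (jS _ Ax) Sa Sy)[/esym].
  - rewrite !asboolF; [|exact: AS|exact: AS].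
    by move=> /(fI _ _ _ _ Sb (jS _ Ax) Sb (jS _ Ay))[_ /jI]; exact.
have [SC|SC] := card_le_total (~` S) S.
  have /card_le_injP[h hS hI] := absorb _ (@subset_refl _ _) SC.
  have hS' x : S (h x) by apply: hS; exact: EM.
  have hI' : injective h by move=> x y; apply: hI; exact: EM.
  apply/card_le_injP; exists (fun p => f (h p.1, h p.2)) => //.
  move=> [x y] [x' y'] _ _ /(fI _ _ _ _ (hS' _) (hS' _) (hS' _) (hS' _)).
  by move=> /= [/hI' -> /hI' ->].
exfalso; move/card_le_injP : SC => [j jS jI].
pose A := j @` S.
have AS : A `<=` ~` S by move=> _ [x Sx <-]; exact: jS.
have /card_le_injP[e eS eI] := absorb _ AS (card_image_le _ _).
pose U := S `|` A.
(* [N] is the graph on the new pairs: compress both coordinates into [S] by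
   [e], combine them by [f] and move the result to [A] by [j]. *)
pose N := [set w : K * K * K | [/\ U w.1.1, U w.1.2, ~ (S w.1.1 /\ S w.1.2)
  & w.2 = j (f (e w.1.1, e w.1.2))]].
have GS x y z : G (x, y, z) -> [/\ S x, S y & S z].
  by move=> Gxyz; have [Sy Sz] := Gran _ _ _ Gxyz; split=> //; exists y, z.
have NA x y z : N (x, y, z) -> A z.
  by move=> [/= Ux Uy _ ->]; exists (f (e x, e y)) => //; apply: fS; exact: eS.
have Ja : A (j a) by exists a.
have nSja : ~ S (j a) by exact: AS.
have Njj x : U x -> N (x, j a, j (f (e x, e (j a)))).
  by move=> Ux; split=> //=; [right|move=> []].
have fldU : fld (G `|` N) = U.
  apply/seteqP; split=> [x [y [z [/GS[Sx _ _]|[]//]]]|x Ux]; first by left.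
  by exists (j a), (j (f (e x, e (j a)))); right; exact: Njj.
apply: (Gmax (G `|` N)).
  split=> [w Gw|/(_ (j a, j a, j (f (e (j a), e (j a)))))]; first by left.
  by move=> /(_ (or_intror (Njj _ (or_intror Ja)))) /GS[].
right; split; last by rewrite fldU; apply: sub_infinite_set fldinf; left.
rewrite /Q fldU; split.
- move=> x y Ux Uy; have [[Sx Sy]|nS] := pselect (S x /\ S y).
    by have [z Gz] := Gtot _ _ Sx Sy; exists z; left.
  by exists (j (f (e x, e y))); right.
- move=> x y z [/GS[_ Sy Sz]|Nxyz]; first by split; left.
  by split; [case: Nxyz|right; exact: NA Nxyz].
- move=> [x y] [x' y'] z [Gp|Np] [Gq|Nq].
  + exact: Ginj Gp Gq.
  + by have [_ _ Sz] := GS _ _ _ Gp; have /(_ Sz) := AS _ (NA _ _ _ Nq).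
  + by have [_ _ Sz] := GS _ _ _ Gq; have /(_ Sz) := AS _ (NA _ _ _ Np).
  + case: Np Nq => /= Ux Uy _ -> [/= Ux' Uy' _].
    have [Sex Sey] := (eS _ Ux, eS _ Uy); have [Sex' Sey'] := (eS _ Ux', eS _ Uy').
    move=> /(jI _ _ (fS (e x, e y) Sex Sey) (fS (e x', e y') Sex' Sey')).
    by move=> /(fI _ _ _ _ Sex Sey Sex' Sey')[/(eI _ _ Ux Ux') -> /(eI _ _ Uy Uy') ->].
Qed.

(** The length of a sequence is recorded separately, so that nested pairing
    has to tell apart only sequences of the same length. *)
Lemma card_le_seq {K : Type} :
  infinite_set [set: K] -> [set: seq K] #<= [set: K].
Proof.
elim/Ppointed: K => K Kinf; first by rewrite empty_eq0 in Kinf *.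
have /card_le_injP[i _ iI] : [set: nat] #<= [set: K] by apply/infiniteP.
have {}iI : injective i by move=> m n; exact: iI.
have /card_le_injP[p _ pI] := card_le_square Kinf.
have {}pI x y x' y' : p (x, y) = p (x', y') -> x = x' /\ y = y'.
  by move=> /(pI _ _ I I)[].
pose code := foldr (fun x c => p (x, c)) point.
have codeI s t : size s = size t -> code s = code t -> s = t.
  elim: s t => [|x s IHs] [|y t] //= [st].
  by move=> /pI[-> /(IHs _ st) ->].
apply/card_le_injP; exists (fun s => p (i (size s), code s)) => // s t _ _.
by move=> /pI[/iI st]; exact: codeI.
Qed.

Lemma card_le_seq_square {K : Type} :
  infinite_set [set: K] -> [set: seq K * seq K] #<= [set: K].
Proof.
elim/Ppointed: K => K Kinf; first by rewrite empty_eq0 in Kinf *.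
have /card_le_injP[c _ cI] := card_le_seq Kinf.
have /card_le_injP[p _ pI] := card_le_square Kinf.
apply/card_le_injP; exists (fun st => p (c st.1, c st.2)) => //.
move=> [s t] [s' t'] _ _ /(pI _ _ I I)[].
by move=> /(cI _ _ I I)-> /(cI _ _ I I)->.
Qed.

(** * Weight *)

Lemma weight_le_basis {X : topologicalType} {K : Type} (B : set (set X)) :
  basis B -> B #<= [set: K] -> weight_le X K.
Proof.
move=> Bbasis BK; have [|B' B'basis B'least] := exists_card_le_least (@basis X).
  by exists B.
by exists B'; [split|apply: card_le_trans (B'least _ Bbasis) BK].
Qed.

Lemma weight_le_family {X : topologicalType} {K : Type} : weight_le X K ->
  exists u : K -> set X, (forall k, open (u k)) /\
    (forall x W, nbhs x W -> exists2 k, u k x & u k `<=` W).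
Proof.
elim/Ppointed: K => K.
  move=> [B [[_ Bnbhs] _]]; rewrite empty_eq0 => /card_le0P B0.
  exists (fun=> set0); split=> [k|x W xW]; first exact: open0.
  by have [U [+ _]] := Bnbhs x W xW; rewrite B0.
move=> [B [[Bopen Bnbhs] _] /pcard_surjP[g gB]].
(* [g] may take values outside [B]; these are replaced by the full set. *)
exists (fun k => if `[< B (g k) >] then g k else setT); split.
  by move=> k; case: asboolP => [/Bopen//|_]; exact: openT.
move=> x W /Bnbhs[U [BU Ux] UW]; have [k _ gk] := gB U BU.
by exists k; rewrite asboolT gk.
Qed.

(** * Topological preliminaries *)

Lemma near_forall_in_seq {T : Type} {I : eqType} (F : set_system T)
    (P : I -> set T) (s : seq I) : Filter F ->
  (forall i, i \in s -> F (P i)) -> F [set x | forall i, i \in s -> P i x].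
Proof.
move=> FF; elim: s => [|i s IHs] FP; first by apply: filterS filterT.
apply: (filterS _ (filterI (FP i (mem_head _ _)) (IHs _))) => [x [Pi Ps] j|j js].
  by rewrite inE => /orP[/eqP->|]//; exact: Ps.
by apply: FP; rewrite inE js orbT.
Qed.

Lemma prod_topology_nbhs {I : eqType} {T : topologicalType}
    (x : prod_topology (fun _ : I => T)) (W : set (prod_topology (fun=> T))) :
  nbhs x W -> exists (s : seq I) (V : I -> set T),
    (forall i, nbhs (x i) (V i)) /\
    (forall y : prod_topology (fun=> T), (forall i, i \in s -> V i (y i)) -> W y).
Proof.
move=> xW.
pose D := [set sV : seq I * (I -> set T) | forall i, nbhs (x i) (sV.2 i)].
pose B (sV : seq I * (I -> set T)) : set (prod_topology (fun _ : I => T)) :=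
  [set y | forall i, i \in sV.1 -> sV.2 i (y i)].
have DB : Filter (filter_from D B).
  apply: filter_from_filter.
    by exists ([::], fun=> setT) => i; exact: filterT.
  move=> [s V] [t V'] Vx V'x; exists (s ++ t, fun i => V i `&` V' i).
    by move=> i; exact: filterI.
  move=> y yP; split=> i ist.
    by have /yP[] : i \in s ++ t by rewrite mem_cat ist.
  by have /yP[] : i \in s ++ t by rewrite mem_cat ist orbT.
have /(_ _ xW)[[s V] Vx sub] : filter_from D B --> x.
  apply/cvg_sup => i A /= [C [[O oO <-] /= Ox OA]].
  exists ([:: i], fun j => [set y | i = j -> O y]).
    move=> j /=; have [<-|ij] := pselect (i = j).
      by apply: filterS (open_nbhs_nbhs (conj oO Ox)) => y Oy _.
    by apply: filterS filterT => y _ /ij.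
  by move=> y /(_ i (mem_head _ _))/(_ erefl)/OA.
by exists s, V.
Qed.

Lemma proj_cts {I : eqType} {T : topologicalType} (i : I) :
  continuous (fun x : prod_topology (fun _ : I => T) => x i).
Proof. exact: proj_continuous. Qed.

(** The quasi-Lindelof property passes to images under set-valued maps, [r] being
    the graph of the map. The hypothesis on covers is local on [S]: it holds
    for compact-valued upper semicontinuous maps, with [E] finite, and, with
    [E] a singleton, for the inverse of a map from [T] to [S] when each point
    of [S] has a neighbourhood whose preimage lies in a member of the cover. *)
Lemma quasi_lindelof_transfer {S T : topologicalType} (r : S -> T -> Prop) :
  (forall t, exists s, r s t) ->
  (forall C : set (set T), C `<=` open -> [set: T] `<=` \bigcup_(U in C) U ->
    forall s : S, exists E : set (set T), [/\ E `<=` C, countable E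
      & \forall s' \near s, forall t, r s' t -> (\bigcup_(U in E) U) t]) ->
  quasi_lindelof S -> quasi_lindelof T.
Proof.
move=> rsurj rC QS C Copen Ccov.
pose good (O : set S) (E : set (set T)) := [/\ E `<=` C, countable E
  & forall s t, O s -> r s t -> (\bigcup_(U in E) U) t].
have [||D [Dsub cD Dcov]] := QS [set O | open O /\ exists E, good O E].
- by move=> O [].
- move=> s _; have [E [EC cE]] := rC C Copen Ccov s.
  rewrite /prop_near1 nbhsE => -[O [oO Os] OE]; exists O => //; split=> //.
  by exists E; split=> // s' t /OE; exact.
have /choice[e eP] : forall O, exists E, D O -> good O E.
  move=> O; have [/Dsub[_ [E OE]]|] := pselect (D O); first by exists E.
  by exists set0.
exists (\bigcup_(O in D) e O); split.
- by move=> U [O /eP[eC _ _] /eC].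
- by apply: bigcup_countable => // O /eP[].
- move=> t _; have [s rst] := rsurj t; have [O DO Os] := Dcov s I.
  have [_ _ /(_ _ _ Os rst)[U eU Ut]] := eP _ DO.
  by exists U => //; exists O.
Qed.

Lemma regular_space_prod {S T : topologicalType} :
  regular_space S -> regular_space T -> regular_space (S * T)%type.
Proof.
move=> regS regT [s t] W [[P Q] /= [/regS[P' sP' P'P] /regT[Q' tQ' Q'Q]] PQW].
exists (P' `*` Q'); first by exists (P', Q').
move=> [x y] cl; apply: PQW; split.
  apply: P'P => B xB; have [|[x' y'] [[P'x _] [Bx _]]] := cl (B `*` setT).
    by exists (B, setT) => //; split=> //; exact: filterT.
  by exists x'.
apply: Q'Q => B yB; have [|[x' y'] [[_ Q'y] [_ By]]] := cl (setT `*` B).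
  by exists (setT, B) => //; split=> //; exact: filterT.
by exists y'.
Qed.

Lemma accessible_space_prod {S T : topologicalType} :
  accessible_space S -> accessible_space T -> accessible_space (S * T)%type.
Proof.
move=> accS accT [s t] [s' t'] /eqP st.
have [ss|/eqP ss] := pselect (s = s').
  have /accT[A [oA]] : t != t' by apply/eqP => tt; apply: st; rewrite ss tt.
  rewrite !inE => At At'; exists (snd @^-1` A); rewrite !inE; split=> //.
  by apply: open_comp => // x _; exact: cvg_snd.
have /accS[A [oA]] := ss.
rewrite !inE => As As'; exists (fst @^-1` A); rewrite !inE; split=> //.
by apply: open_comp => // x _; exact: cvg_fst.
Qed.

Lemma clopen_basis_regular {T : topologicalType} (B : set (set T)) :
  basis B -> B `<=` clopen -> regular_space T.
Proof.
move=> [Bopen Bnbhs] Bclopen x W /Bnbhs[U [BU Ux] UW].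
exists U; first by apply: open_nbhs_nbhs; split=> //; exact: Bopen.
by have [_ /closure_id <-] := Bclopen _ BU.
Qed.

(** The filter of sets containing a sufficiently large finite subset of [D]; it
    lets a compactness argument produce a finite subcover and a finite set of
    coordinates at the same time as a neighbourhood. *)
Definition at_finite {I : Type} (D : set I) : set_system (set I) :=
  filter_from [set s | finite_set s /\ s `<=` D] (fun s => [set t | s `<=` t]).

Lemma at_finite_filter {I : Type} (D : set I) : Filter (at_finite D).
Proof.
apply: filter_from_filter; first by exists set0; split=> //; exact: finite_set0.
move=> s t [fs sD] [ft tD]; exists (s `|` t).
  by split; [rewrite finite_setU|rewrite subUset].
by move=> r rst; split; apply: subset_trans rst; [left|right].
Qed.

(** * The space of supersets of traces *)

Definition upper_hull {K X : Type} (u : K -> set X) :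
    set (prod_topology (fun _ : K => bool)) :=
  [set f | exists x, forall k, u k x -> f k].

Section UpperHull.
Context {K : choiceType} {X : topologicalType} (u : K -> set X).

Local Notation Y := (set_type (upper_hull u)).

Definition trace x : prod_topology (fun _ : K => bool) := fun k => `[< u k x >].

Lemma trace_upper_hull x : upper_hull u (trace x).
Proof. by exists x => k ukx; exact/asboolP. Qed.

Lemma coord_continuous k : continuous (fun y : Y => val y k).
Proof.
move=> y; apply: (@continuous_comp Y _ bool val (fun f => f k)).
  exact: initial_continuous.
exact: proj_cts.
Qed.

Lemma near_coord (y : Y) k : \forall y' \near y, val y' k = val y k.
Proof.
have /(@coord_continuous k y) : nbhs (val y k) [set val y k] by [].
exact.
Qed.

Lemma upper_hull_nbhs (y : Y) (W : set Y) : nbhs y W ->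
  exists s : seq K, forall y' : Y,
    (forall k, k \in s -> val y' k = val y k) -> W y'.
Proof.
move=> [_ [[O oO <-] /= Oy OW]].
have [s [V [Vy VO]]] := prod_topology_nbhs (val y) O (open_nbhs_nbhs (conj oO Oy)).
exists s => y' yy'; apply: OW; apply: VO => k ks.
have -> : set_val y' k = set_val y k by exact: yy'.
exact: nbhs_singleton (Vy k).
Qed.

Definition cylinder (st : seq K * seq K) : set Y :=
  [set y : Y | (forall k, k \in st.1 -> val y k) /\
               (forall k, k \in st.2 -> ~~ val y k)].

Lemma cylinder_clopen st : clopen (cylinder st).
Proof.
split.
  rewrite openE => y [y1 y2].
  apply: (filterS _ (near_forall_in_seq _ _ (st.1 ++ st.2) _
    (fun k _ => near_coord y k))) => y' yy'.
  by split=> k kst; rewrite yy' ?mem_cat ?kst ?orbT //; [exact: y1|exact: y2].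
move=> y cl; split=> k kst; have [y' [[y1 y2] <-]] := cl _ (near_coord y k).
  exact: y1.
exact: y2.
Qed.

Lemma cylinder_basis : basis (range cylinder).
Proof.
split=> [_ [st _ <-]|y W /upper_hull_nbhs[s sW]]; first exact: (cylinder_clopen st).1.
exists (cylinder ([seq k <- s | val y k], [seq k <- s | ~~ val y k])) => /=.
  by split; [exists ([seq k <- s | val y k], [seq k <- s | ~~ val y k])|
     split=> k /=; rewrite mem_filter => /andP[]].
move=> y' [/= y1 y2]; apply: sW => k ks; case yk : (val y k).
  by apply: y1; rewrite mem_filter yk.
by apply/negbTE/y2; rewrite mem_filter yk ks.
Qed.

Lemma upper_hull_accessible : accessible_space Y.
Proof.
move=> y y' /eqP yy'.
have [k yk] : exists k, val y k <> val y' k.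
  apply/existsNP => yk; apply: yy'; apply: val_inj; apply/funext => k; exact: yk.
exists ((fun y : Y => val y k) @^-1` [set val y k]); rewrite !inE; split=> //.
  by apply: open_comp => [z _|]; [exact: coord_continuous|exact: discrete_open].
by move=> /esym.
Qed.

Lemma upper_hull_regular : regular_space Y.
Proof.
by apply: clopen_basis_regular cylinder_basis _ => _ [st _ <-]; exact: cylinder_clopen.
Qed.

Lemma upper_set_compact x :
  compact [set f : prod_topology (fun _ : K => bool) | forall k, u k x -> f k].
Proof.
have : forall k, compact [set b : bool | u k x -> b].
  move=> k; apply: finite_compact; apply: finite_finset.
by move/tychonoff.
Qed.

(** For [x] in [X] and [z] in [Z], compactness of the upper set above the
    trace of [x] gives a finite part [E] of the cover, a finite set [t] of
    coordinates and a neighbourhood [B] of [z] such that [E] covers [(y, z')]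
    whenever [z'] is in [B] and [y] agrees on [t] with a member of the upper
    set. If [x'] lies in all [u k] with [k] in [t] that contain [x], any [y]
    above the trace of [x'] agrees on [t] with the join of [y] and the trace
    of [x], which is a member of the upper set. *)
Lemma upper_hull_prod_quasi_lindelof (Z : topologicalType) :
  (forall k, open (u k)) ->
  quasi_lindelof (X * Z)%type -> quasi_lindelof (Y * Z)%type.
Proof.
move=> u_open.
apply: (@quasi_lindelof_transfer (X * Z)%type (Y * Z)%type (fun p q =>
   (forall k, u k p.1 -> val q.1 k) /\ p.2 = q.2)).
  by move=> [[f fY] z]; have [x xf] := set_mem fY; exists (x, z).
move=> C Copen Ccov [x z].
pose P (i : (set (set (Y * Z)) * set K) * Z) (f : prod_topology (fun _ : K => bool)) :=
  forall y : Y, (forall k, i.1.2 k -> val y k = f k) ->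
    (\bigcup_(W in i.1.1) W) (y, i.2).
have /compact_near_coveringP/(_ _ (filter_prod
  (filter_prod (at_finite C) (at_finite [set: K])) (nbhs z)) P) := upper_set_compact x.
have FC := at_finite_filter C; have FK := at_finite_filter [set: K].
case.
  move=> f xf; have fY : f \in upper_hull u by apply/mem_set; exists x.
  have [W CW Wfz] := Ccov (exist _ f fY, z) I.
  have : nbhs (exist _ f fY : Y, z) W by apply: open_nbhs_nbhs; split=> //; exact: Copen.
  move=> [[A B] /= [/upper_hull_nbhs[s sA] zB] ABW].
  exists ([set f' | forall k, k \in s -> f' k = f k],
     ([set E | [set W] `<=` E] `*` [set t | [set` s] `<=` t]) `*` B).
    split=> /=.
      apply: near_forall_in_seq => k _.
      have /(proj_cts k f) : nbhs (f k) [set f k] by [].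
      exact.
    exists ([set E | [set W] `<=` E] `*` [set t | [set` s] `<=` t], B) => //.
    split=> //=.
    exists ([set E | [set W] `<=` E], [set t | [set` s] `<=` t]) => //.
    split=> /=.
      by exists [set W] => //; split; [exact: finite_set1|move=> _ ->].
    by exists [set` s] => //; split=> //; exact: finite_seq.
  move=> [f' [[E t] z']] /= [ff' [[WE st] Bz']] y yf'.
  exists W; first exact: WE.
  by apply: ABW; split=> //=; apply: sA => k ks; rewrite yf' ?ff' //; exact: st.
move=> [Q B] /= [[[Q1 Q2] /= [[E [finE EC] EQ1] [t [fint _] tQ2]] QQ] zB] QBP.
exists E; split=> //; first exact: finite_set_countable.
exists ([set x' | forall k, t k -> u k x -> u k x'], B) => /=.
  split=> //; have /finite_seqP[s ->] := fint.
  apply: near_forall_in_seq => k _ /=.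
  have [ukx|nukx] := pselect (u k x); last by apply: filterS filterT.
  by apply: filterS (open_nbhs_nbhs (conj (u_open k) ukx)).
move=> [x' z'] /= [tx' Bz'] [y z''] /= [x'y <-].
have /(QBP (E, t, z')) /(_ (fun k => val y k || `[< u k x >])) : (Q `*` B) (E, t, z').
  by split=> //=; apply: QQ; split; [exact: EQ1|exact: tQ2].
apply=> [k ukx|k tk]; first by rewrite asboolT // orbT.
have [ukx|nukx] := pselect (u k x); last by rewrite (asboolF nukx) orbF.
by rewrite (asboolT ukx) orbT; apply: x'y; exact: tx'.
Qed.

(** A point [y] lies above the traces of some sequence [x], which belongs to a
    member [W] of the cover. Some finitely many conditions [u (k i) (x i)]
    guarantee membership in [W]. The corresponding bits of [y] are true, and
    they stay true near [y]; so every sequence whose traces are near [y]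
    belongs to [W]. *)
Lemma omega_power_quasi_lindelof_upper_hull :
  (forall x W, nbhs x W -> exists2 k, u k x & u k `<=` W) ->
  quasi_lindelof (omega_power Y) -> quasi_lindelof (omega_power X).
Proof.
move=> u_nbhs.
apply: (@quasi_lindelof_transfer (omega_power Y) (omega_power X) (fun (y : omega_power Y) (x : omega_power X) =>
   forall i, val (y i) = trace (x i))).
  by move=> x; exists (fun i => exist _ (trace (x i)) (mem_set (trace_upper_hull (x i)))).
move=> C Copen Ccov y.
have /choice[x xy] : forall i, exists x, forall k, u k x -> val (y i) k.
  by move=> i; exact: set_valP (y i).
have [W CW Wx] := Ccov (x : omega_power X) I.
have [s [V [Vx VW]]] := prod_topology_nbhs (x : omega_power X) W
  (open_nbhs_nbhs (conj (Copen _ CW) Wx)).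
have /choice[k kP] : forall i, exists k, u k (x i) /\ u k `<=` V i.
  by move=> i; have [k ? ?] := u_nbhs _ _ (Vx i); exists k.
exists [set W]; split; first by move=> _ ->.
  exact: countable1.
apply: (filterS _ (near_forall_in_seq _
   (fun i => [set y' : omega_power Y | val (y' i) (k i) = val (y i) (k i)]) s _ _)).
  move=> y' yy' x' x'y; exists W => //; apply: VW => i /yy' /=.
  by rewrite x'y (xy _ _ (kP i).1) => /asboolP; exact: (kP i).2.
move=> i _; have /(proj_cts i y) := near_coord (y i) (k i); exact.
Qed.

End UpperHull.

Theorem theorem6p2 (K : Type) (hK : infinite_set [set: K]) :
  (exists X : topologicalType,
     [/\ productively_quasi_lindelof X, weight_le X K
       & ~ powerfully_quasi_lindelof X]) ->
  exists Y : topologicalType,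
    [/\ zero_dimensional_space Y, productively_lindelof Y, weight_le Y K
      & ~ powerfully_lindelof Y].
Proof.
elim/Pchoice: K => K in hK *.
move=> [X [XZ /weight_le_family[u [u_open u_nbhs]] Xomega]].
have [x0 _] : [set: X] !=set0.
  apply/set0P/eqP => X0; apply: Xomega => C Copen Ccov.
  exists set0; split=> // f _; have : [set: X] (f 0%N) by [].
  by rewrite X0.
exists (set_type (upper_hull u)); split.
- split.
  + by exists (exist _ (trace u x0) (mem_set (trace_upper_hull u x0)) :
      set_type (upper_hull u)).
  + exact: upper_hull_accessible.
  + exists (range (cylinder u)); first exact: cylinder_basis.
    by move=> _ [st _ <-]; exact: cylinder_clopen.
- move=> Z ZL; have [ZT1 Zreg _] := ZL; split.
  + by apply: accessible_space_prod ZT1; exact: upper_hull_accessible.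
  + by apply: regular_space_prod Zreg; exact: upper_hull_regular.
  + by apply: upper_hull_prod_quasi_lindelof => //; exact: XZ.
- apply: weight_le_basis (cylinder_basis u) _.
  exact: card_le_trans (card_image_le _ _) (card_le_seq_square hK).
- by move=> [_ _ /omega_power_quasi_lindelof_upper_hull Q]; exact/Xomega/Q.
Qed.
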